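(* Every simple $\mathcal H_{n,r}(0)$-module is isomorphic to $S_{[I,\mathbf c]}$ for some cycloribbon $[I,\mathbf c]$ of size $n$; that is, the modules $S_{[I,\mathbf c]}$ form a complete family of simple $\mathcal H_{n,r}(0)$-modules (in particular all simple modules are one-dimensional).
   Context: Fix integers $n,r\ge1$ and distinct complex numbers $u_1,\dots,u_r$; let $P_k(X)=\prod_{l\ne k}\frac{X-u_l}{u_k-u_l}$. $\mathcal H_{n,r}(0)$ is the unital $\mathbb C$-algebra with generators $T_1,\dots,T_{n-1},\xi_1,\dots,\xi_n$ and relations: $T_i(T_i+1)=0$; $T_iT_{i+1}T_i=T_{i+1}T_iT_{i+1}$; $T_iT_j=T_jT_i$ ($|i-j|\ge2$); $\prod_{k=1}^r(\xi_j-u_k)=0$; $\xi_i\xi_j=\xi_j\xi_i$; $T_i\xi_i=\xi_{i+1}T_i+\sum_{1\le a<b\le r}(u_b-u_a)P_a(\xi_i)P_b(\xi_{i+1})$; $T_i(\xi_i+\xi_{i+1})=(\xi_i+\xi_{i+1})T_i$; $T_i\xi_j=\xi_jT_i$ ($j\notin\{i,i+1\}$). The $T_i$ generate the $0$-Hecke algebra $H_n(0)$. For a color word $\mathbf c\in\{1,\dots,r\}^n$, $L_{\mathbf c}=P_{c_1}(\xi_1)\cdots P_{c_n}(\xi_n)$. For a composition $I$ of $n$ with descent set $D(I)$ (partial sums excluding $n$), $\eta_I$ is a nonzero element of $H_n(0)$ with $-T_i\eta_I=\eta_I$ for $i\in D(I)$ and $(1+T_i)\eta_I=\eta_I$ otherwise.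 A cycloribbon is a pair $[I,\mathbf c]$ with $I$ a composition of $n$ and $\mathbf c$ a color word of length $n$ such that $i\in D(I)\Rightarrow c_i\ge c_{i+1}$ and $i\notin D(I)\Rightarrow c_i\le c_{i+1}$. For such, $S_{[I,\mathbf c]}:=\mathcal H_{n,r}(0)\,L_{\mathbf c}\eta_I$ (a left ideal of $\mathcal H_{n,r}(0)$). *)

(* Defs.v *)
From HB Require Import structures.
From mathcomp Require Import all_boot all_order all_algebra.
From mathcomp Require Import boolp reals complex.
From mathcomp Require Import finmap monalg.

Set Implicit Arguments.
Unset Strict Implicit.
Unset Printing Implicit Defensive.

Import GRing.Theory.
Local Open Scope ring_scope.
Local Open Scope quotient_scope.

Definition two_sided_ideal (A : pzRingType) (J : {pred A}) : Prop :=
  [/\ zmod_closed J,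
      forall a x, x \in J -> a * x \in J
    & forall a x, x \in J -> x * a \in J].

(* Membership is made boolean by classical logic so that the quotient
   constructions apply. *)
Definition ideal_gen (A : pzRingType) (S : A -> Prop) : {pred A} :=
  fun x => `[< forall J : {pred A}, two_sided_ideal J ->
                 (forall y, S y -> y \in J) -> x \in J >].

Section IdealGen.
Variables (A : pzRingType) (S : A -> Prop).

Lemma ideal_genP x :
  reflect (forall J : {pred A}, two_sided_ideal J ->
             (forall y, S y -> y \in J) -> x \in J)
          (x \in ideal_gen S).
Proof. exact: asboolP. Qed.

Lemma ideal_gen_two_sided : two_sided_ideal (ideal_gen S).
Proof.
split=> [|a x|a x].
- split=> [|x y].
    by apply/ideal_genP => J [[]].
  move=> /ideal_genP xJ /ideal_genP yJ; apply/ideal_genP => J idJ SJ.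
  by case: (idJ) => -[_ JB] _ _; apply: JB; [exact: xJ | exact: yJ].
- move=> /ideal_genP xJ; apply/ideal_genP => J idJ SJ.
  by case: (idJ) => _ JM _; apply/JM/xJ.
- move=> /ideal_genP xJ; apply/ideal_genP => J idJ SJ.
  by case: (idJ) => _ _ JM; apply/JM/xJ.
Qed.

Lemma mem_ideal_gen x : S x -> x \in ideal_gen S.
Proof. by move=> Sx; apply/ideal_genP => J _; apply. Qed.

HB.instance Definition _ :=
  GRing.isZmodClosed.Build A (ideal_gen S)
    (let: And3 h _ _ := ideal_gen_two_sided in h).

Lemma ideal_genMl a x : x \in ideal_gen S -> a * x \in ideal_gen S.
Proof. by case: ideal_gen_two_sided => _ h _; apply: h. Qed.

Lemma ideal_genMr a x : x \in ideal_gen S -> x * a \in ideal_gen S.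
Proof. by case: ideal_gen_two_sided => _ _ h; apply: h. Qed.

End IdealGen.

Section LeftIdeal.
Variables (A : nzRingType) (x : A).

Definition principal_pred : {pred A^o} :=
  fun y => `[< exists a : A, y = a * x >].

Lemma principal_closed : submod_closed principal_pred.
Proof.
split=> [|a _ _ /asboolP[b ->] /asboolP[c ->]]; apply/asboolP.
  by exists 0; rewrite mul0r.
by exists (a * b + c); rewrite mulrDl -mulrA.
Qed.

HB.instance Definition _ :=
  GRing.isSubmodClosed.Build A A^o principal_pred principal_closed.

Record principal_lideal := PrincipalLideal {
  principal_val :> A^o;
  _ : principal_val \in principal_pred }.

HB.instance Definition _ := [isSub for principal_val].
HB.instance Definition _ := [Choice of principal_lideal by <:].
HB.instance Definition _ := [SubChoice_isSubLmodule of principal_lideal by <:].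

End LeftIdeal.

Definition simple_module (A : pzRingType) (M : lmodType A) : Prop :=
  (exists x : M, x != 0) /\
  (forall N : {pred M}, submod_closed N ->
     (forall x, x \in N -> x = 0) \/ (forall x, x \in N)).

Definition isomorphic_modules (A : pzRingType) (M N : lmodType A) : Prop :=
  exists f : {linear M -> N}, bijective f.

Definition one_dimensional (F : fieldType) (A : lalgType F) (M : lmodType A) :
    Prop :=
  exists2 v : M, v != 0 & forall x : M, exists a : F, x = a%:A *: v.

Section Hecke.
Variables (F : fieldType) (n r : nat) (u : 'I_r.+1 -> F).

(* The value P_k(x) of the Lagrange polynomial; all its factors commute. *)
Definition lagrange (A : lalgType F) (k : 'I_r.+1) (x : A) : A :=
  \prod_(l < r.+1 | l != k) ((u k - u l)^-1 *: (x - (u l)%:A)).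

(* Indices start at 0: [i : 'I_n] stands for i + 1, and [pos i], [pos_next i]
   stand for i + 1 and i + 2 in {1, ..., n + 1}. *)
Definition pos (i : 'I_n) : 'I_n.+1 := widen_ord (leqnSn n) i.
Definition pos_next (i : 'I_n) : 'I_n.+1 := lift ord0 i.

Section Relations.
Variables (A : lalgType F) (T : 'I_n -> A) (xi : 'I_n.+1 -> A).

Inductive hecke_relation : A -> A -> Prop :=
| rel_quad (i : 'I_n) :
    hecke_relation (T i * (T i + 1)) 0
| rel_braid (i j : 'I_n) : j = i.+1 :> nat ->
    hecke_relation (T i * T j * T i) (T j * T i * T j)
| rel_TT (i j : 'I_n) : (i.+2 <= j)%N || (j.+2 <= i)%N ->
    hecke_relation (T i * T j) (T j * T i)
| rel_cyclotomic (j : 'I_n.+1) :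
    hecke_relation (\prod_(k < r.+1) (xi j - (u k)%:A)) 0
| rel_xixi (i j : 'I_n.+1) :
    hecke_relation (xi i * xi j) (xi j * xi i)
| rel_Txi (i : 'I_n) :
    hecke_relation (T i * xi (pos i))
      (xi (pos_next i) * T i
       + \sum_(a < r.+1) \sum_(b < r.+1 | (a < b)%N)
           (u b - u a) *: (lagrange a (xi (pos i))
                           * lagrange b (xi (pos_next i))))
| rel_Txi_sum (i : 'I_n) :
    hecke_relation (T i * (xi (pos i) + xi (pos_next i)))
                   ((xi (pos i) + xi (pos_next i)) * T i)
| rel_Txi_far (i : 'I_n) (j : 'I_n.+1) : j != pos i -> j != pos_next i ->
    hecke_relation (T i * xi j) (xi j * T i).

Lemma hecke_relation_character (f : {rmorphism A -> F}) x y :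
    (forall a z, f (a *: z) = a * f z) ->
    (forall i, f (T i) = 0) -> (forall j, f (xi j) = u ord0) ->
  hecke_relation x y -> f x = f y.
Proof.
move=> fZ fT fxi; have falg a : f a%:A = a by rewrite fZ rmorph1 mulr1.
have fP (k : 'I_r.+1) j : k != ord0 -> f (lagrange k (xi j)) = 0.
  move=> k0; rewrite rmorph_prod; apply/eqP/prodf_eq0.
  by exists ord0; rewrite 1?eq_sym //= fZ rmorphB /= fxi falg subrr mulr0.
case=> [i|i j _|i j _|j|i j|i|i|i j _ _]; rewrite ?rmorphM /= ?fT ?mul0r ?mulr0 //.
- by rewrite rmorph0.
- rewrite rmorph_prod rmorph0; apply/eqP/prodf_eq0.
  by exists ord0; rewrite //= rmorphB /= fxi falg subrr.
- by rewrite mulrC.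
- rewrite rmorphD rmorphM /= fT mulr0 add0r rmorph_sum big1 //= => a _.
  rewrite rmorph_sum big1 //= => b ab.
  have b0 : b != ord0 by apply: contraTneq ab => ->.
  by rewrite fZ rmorphM /= (fP _ _ b0) !mulr0.
Qed.

End Relations.

(* The free algebra on T_1, ..., T_n, xi_1, ..., xi_(n+1). *)
Definition free_algebra : Type := {malg F[{fmonom ('I_n + 'I_n.+1)%type}]}.

HB.instance Definition _ := GRing.Lalgebra.on free_algebra.

Definition fgen (g : 'I_n + 'I_n.+1) : free_algebra := mkmalgU (fmu g) 1.
Definition fT (i : 'I_n) : free_algebra := fgen (inl i).
Definition fxi (j : 'I_n.+1) : free_algebra := fgen (inr j).

Definition hecke_ideal : {pred free_algebra} :=
  ideal_gen (fun z => exists x y, hecke_relation fT fxi x y /\ z = x - y).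

HB.instance Definition _ := GRing.ZmodClosed.on hecke_ideal.

Definition hecke : Type := Quotient.quot hecke_ideal.

HB.instance Definition _ := GRing.Zmodule.on hecke.

Definition hpi (x : free_algebra) : hecke := \pi_(Quotient.quot hecke_ideal) x.

Lemma hpi_surj (x : hecke) : exists y, x = hpi y.
Proof. by exists (repr x); rewrite /hpi reprK. Qed.

Lemma hpiB : {morph hpi : x y / x - y}.
Proof. by move=> x y; rewrite /hpi raddfB. Qed.

Lemma hpiD : {morph hpi : x y / x + y}.
Proof. by move=> x y; rewrite /hpi raddfD. Qed.

Lemma hpiP x y : hpi x = hpi y <-> x - y \in hecke_ideal.
Proof. by rewrite Quotient.idealrBE; split=> [/eqP|/eqP]. Qed.

Definition hone : hecke := hpi 1.
Definition hmul (x y : hecke) : hecke :=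
  hpi (repr (x : Quotient.quot hecke_ideal) *
       repr (y : Quotient.quot hecke_ideal)).
Definition hscale (a : F) (x : hecke) : hecke :=
  hpi (a *: repr (x : Quotient.quot hecke_ideal)).

Lemma repr_hpi x :
  repr (hpi x : Quotient.quot hecke_ideal) - x \in hecke_ideal.
Proof. by apply/hpiP; rewrite /hpi reprK. Qed.

Lemma hmulE x y : hmul (hpi x) (hpi y) = hpi (x * y).
Proof.
apply/hpiP; set x' := repr _; set y' := repr _.
have -> : x' * y' - x * y = (x' - x) * y' + x * (y' - y).
  by rewrite mulrBl mulrBr addrA subrK.
by apply: rpredD; [apply: ideal_genMr | apply: ideal_genMl]; apply: repr_hpi.
Qed.

Lemma hscaleE a x : hscale a (hpi x) = hpi (a *: x).
Proof.
apply/hpiP; rewrite -scalerBr -[_ - x]mul1r scalerAl.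
by apply: ideal_genMl; apply: repr_hpi.
Qed.

Lemma hmulA : associative hmul.
Proof.
move=> x y z; have [[[x' ->] [y' ->]] [z' ->]] :=
  (hpi_surj x, hpi_surj y, hpi_surj z).
by rewrite !hmulE mulrA.
Qed.

Lemma hmul1 : left_id hone hmul.
Proof. by move=> x; have [x' ->] := hpi_surj x; rewrite hmulE mul1r. Qed.

Lemma hmulr1 : right_id hone hmul.
Proof. by move=> x; have [x' ->] := hpi_surj x; rewrite hmulE mulr1. Qed.

Lemma hmulDl : left_distributive hmul +%R.
Proof.
move=> x y z; have [[[x' ->] [y' ->]] [z' ->]] :=
  (hpi_surj x, hpi_surj y, hpi_surj z).
by rewrite -hpiD !hmulE -hpiD mulrDl.
Qed.

Lemma hmulDr : right_distributive hmul +%R.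
Proof.
move=> x y z; have [[[x' ->] [y' ->]] [z' ->]] :=
  (hpi_surj x, hpi_surj y, hpi_surj z).
by rewrite -hpiD !hmulE -hpiD mulrDr.
Qed.

(* T_i |-> 0, xi_j |-> u_1 is a character, hence 1 != 0 in the quotient. *)
Section Character.

Definition chi_mon (m : {fmonom ('I_n + 'I_n.+1)%type}) : F :=
  \prod_(g <- fmonom_val m) (if g is inr _ then u ord0 else 0).

Lemma chi_mon_morph : mmorphism chi_mon.
Proof.
split=> [x y|]; rewrite /chi_mon.
  by rewrite fmM big_cat.
by rewrite fm1 big_nil.
Qed.

HB.instance Definition _ := isMultiplicative.Build _ _ chi_mon chi_mon_morph.

Definition chi : free_algebra -> F := mmap idfun chi_mon.

HB.instance Definition _ := GRing.RMorphism.on chi.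

Lemma chi_relation x y : hecke_relation fT fxi x y -> chi x = chi y.
Proof.
apply: hecke_relation_character => [a z|i|j].
- exact: mmapZ.
- by rewrite /= /chi /fT /fgen mmapU /= /chi_mon fmU big_seq1 mulr0.
- by rewrite /= /chi /fxi /fgen mmapU /= /chi_mon fmU big_seq1 mul1r.
Qed.

End Character.

Lemma hone_neq0 : hone != 0.
Proof.
apply/eqP => h; have : (1 : free_algebra) - 0 \in hecke_ideal.
  by apply/hpiP; rewrite -/hone h /hpi raddf0.
rewrite subr0 => /ideal_genP /(_ [pred x | chi x == 0]) H1.
suff : chi 1 == 0 by rewrite rmorph1 oner_eq0.
apply: H1 => [|_ [x [y [/chi_relation xy ->]]]].
- split=> [|a x|a x]; last 2 first.
  + by rewrite !inE => /eqP x0; rewrite rmorphM /= x0 mulr0.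
  + by rewrite !inE => /eqP x0; rewrite rmorphM /= x0 mul0r.
  split=> [|x y]; first by rewrite inE rmorph0.
  by rewrite !inE => /eqP x0 /eqP y0; rewrite rmorphB /= x0 y0 subr0.
- by rewrite inE rmorphB /= xy subrr.
Qed.

HB.instance Definition _ :=
  GRing.Zmodule_isNzRing.Build hecke hmulA hmul1 hmulr1 hmulDl hmulDr hone_neq0.

Lemma hscaleA a b x : hscale a (hscale b x) = hscale (a * b) x.
Proof. by have [x' ->] := hpi_surj x; rewrite !hscaleE scalerA. Qed.

Lemma hscale1 : left_id 1 hscale.
Proof. by move=> x; have [x' ->] := hpi_surj x; rewrite hscaleE scale1r. Qed.

Lemma hscaleDr : right_distributive hscale +%R.
Proof.
move=> a x y; have [[x' ->] [y' ->]] := (hpi_surj x, hpi_surj y).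
by rewrite -hpiD !hscaleE -hpiD scalerDr.
Qed.

Lemma hscaleDl x : {morph hscale^~ x : a b / a + b}.
Proof.
by move=> a b; have [x' ->] := hpi_surj x; rewrite !hscaleE -hpiD scalerDl.
Qed.

HB.instance Definition _ :=
  GRing.Zmodule_isLmodule.Build F hecke hscaleA hscale1 hscaleDr hscaleDl.

Lemma hscaleAl (a : F) (x y : hecke) : a *: (x * y) = (a *: x) * y.
Proof.
have [[x' ->] [y' ->]] := (hpi_surj x, hpi_surj y).
rewrite -[LHS]/(hscale a (hmul _ _)) -[RHS]/(hmul (hscale a _) _).
by rewrite hmulE !hscaleE hmulE scalerAl.
Qed.

HB.instance Definition _ := GRing.Lmodule_isLalgebra.Build F hecke hscaleAl.

Lemma free_scalerAr (a : F) (x y : free_algebra) : a *: (x * y) = x * (a *: y).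
Proof.
apply/malgP => k; rewrite mcoeffZ mcoeffMl.
rewrite (mcoeffMlw _ (fsubset_refl _) (msuppZ_le _ _)) mulr_sumr.
apply: eq_bigr => k1 _; rewrite mulr_sumr; apply: eq_bigr => k2 _.
by rewrite mcoeffZ mulrnAr mulrCA.
Qed.

Lemma hscaleAr (a : F) (x y : hecke) : a *: (x * y) = x * (a *: y).
Proof.
have [[x' ->] [y' ->]] := (hpi_surj x, hpi_surj y).
rewrite -[LHS]/(hscale a (hmul _ _)) -[RHS]/(hmul _ (hscale a _)).
by rewrite hmulE !hscaleE hmulE free_scalerAr.
Qed.

HB.instance Definition _ := GRing.Lalgebra_isAlgebra.Build F hecke hscaleAr.

Definition hT (i : 'I_n) : hecke := hpi (fT i).
Definition hxi (j : 'I_n.+1) : hecke := hpi (fxi j).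

(* The 0-Hecke algebra H_(n+1)(0), as the subalgebra generated by the T_i. *)
Definition in_hecke0 (x : hecke) : Prop :=
  forall B : {pred hecke}, subalg_closed B -> (forall i, hT i \in B) -> x \in B.

End Hecke.

Record composition (m : nat) := Composition {
  parts :> seq nat;
  _ : all (leq 1) parts && (sumn parts == m) }.

Definition descents (m : nat) (I : composition m) : seq nat :=
  [seq sumn (take k I) | k <- iota 1 (size I).-1].

Definition is_descent (n : nat) (I : composition n.+1) (i : 'I_n) : bool :=
  i.+1 \in descents I.

Definition cycloribbon (n r : nat) (I : composition n.+1)
    (c : {ffun 'I_n.+1 -> 'I_r.+1}) : Prop :=
  forall i : 'I_n,
    (is_descent I i -> (c (pos_next i) <= c (pos i))%N) /\
    (~~ is_descent I i -> (c (pos i) <= c (pos_next i))%N).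

Section Modules.
Variables (F : fieldType) (n r : nat) (u : 'I_r.+1 -> F).

Definition is_eta (I : composition n.+1) (e : hecke n u) : Prop :=
  [/\ in_hecke0 e, e != 0,
      forall i : 'I_n, is_descent I i -> - hT u i * e = e
    & forall i : 'I_n, ~~ is_descent I i -> (1 + hT u i) * e = e].

Definition color_idempotent (c : {ffun 'I_n.+1 -> 'I_r.+1}) : hecke n u :=
  \prod_(j < n.+1) lagrange u (c j) (hxi u j).

Definition cycloribbon_module (e : hecke n u) (c : {ffun 'I_n.+1 -> 'I_r.+1}) :
    lmodType (hecke n u) :=
  principal_lideal (color_idempotent c * e).

End Modules.

(* Main.v *)
From HB Require Import structures.
From mathcomp Require Import all_boot all_order all_algebra fingroup perm.
From mathcomp Require Import ring zify boolp reals complex.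
From mathcomp Require Import finmap monalg.
Require Import Defs.

Set Implicit Arguments.
Unset Strict Implicit.
Unset Printing Implicit Defensive.

Import Order.TTheory GRing.Theory Num.Theory.
Local Open Scope ring_scope.

(* The primitive idempotents [L_c] of the subalgebra generated by the [xi_j]
   satisfy T_i L_c = L_{s_i c} T_i + [c_i > c_{i+1}] L_{s_i c}
   - [c_i < c_{i+1}] L_c, so for a cycloribbon [I, c] the vector L_c eta_I is a
   common eigenvector of all generators. It is nonzero because the algebra acts
   on functions from colors to itself in such a way that the T_i act on constant
   functions by left multiplication: then L_c eta_I sends the constant function 1
   to eta_I supported at c.

   Conversely, a nonzero module contains a common eigenvector v of the T_i. Among
   the colors c with L_c v <> 0, one that maximizes sum_j h(j) c_j, where h goes
   down by 1 at the i with T_i v = - v and up by 1 at the others, makes L_c v an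
   eigenvector of the T_i as well: any unwanted swap of c would increase that sum.
   A simple module is therefore a line, determined by its eigenvalues. *)

(** * Linear identities in a module *)

Section ModuleReflection.
Variables (R : comNzRingType) (V : lmodType R).

(** Syntax of linear expressions, for proofs by reflection: an identity in [V] holds once the
    coefficients of each atom agree in [R], which is left to [ring]. *)
Inductive mexpr :=
  | MVar of nat | MZero | MAdd of mexpr & mexpr | MOpp of mexpr
  | MScale of R & mexpr.

Fixpoint meval (env : seq V) e : V :=
  match e with
  | MVar k => env`_k
  | MZero => 0
  | MAdd e1 e2 => meval env e1 + meval env e2
  | MOpp e1 => - meval env e1
  | MScale a e1 => a *: meval env e1
  end.

Fixpoint mcoef e (k : nat) : R :=
  match e with
  | MVar l => if eqn l k then 1 else 0
  | MZero => 0
  | MAdd e1 e2 => mcoef e1 k + mcoef e2 k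
  | MOpp e1 => - mcoef e1 k
  | MScale a e1 => a * mcoef e1 k
  end.

(** A recursive conjunction, which [cbn] unfolds into one ring equation for each atom. *)
Fixpoint mcoefs_eq e1 e2 m : Prop :=
  if m is m'.+1 then mcoef e1 m' = mcoef e2 m' /\ mcoefs_eq e1 e2 m' else True.

Lemma mevalE env e : meval env e = \sum_(k < size env) mcoef e k *: env`_k.
Proof.
elim: e => /= [l||e1 -> e2 ->|e1 ->|a e1 ->].
- have [lt_l|le_l] := ltnP l (size env); last first.
    (* An index beyond the environment denotes the default value 0 and contributes nothing to the
       sum. *)
    rewrite nth_default // big1 // => k _.
    have -> : eqn l k = false; last by rewrite scale0r.
    by apply: contraTF le_l => /eqnP->; rewrite -ltnNge.
  rewrite (bigD1 (Ordinal lt_l)) //= eqnE eqxx scale1r big1 ?addr0 // => k kl.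
  by rewrite -val_eqE /= eq_sym in kl; rewrite (negPf kl) scale0r.
- by rewrite big1 // => k _; rewrite scale0r.
- by rewrite -big_split; apply: eq_bigr => k _; rewrite scalerDl.
- by rewrite -sumrN; apply: eq_bigr => k _; rewrite scaleNr.
- by rewrite scaler_sumr; apply: eq_bigr => k _; rewrite scalerA.
Qed.

Lemma meval_eq env e1 e2 :
  mcoefs_eq e1 e2 (size env) -> meval env e1 = meval env e2.
Proof.
rewrite !mevalE => eq12; apply: eq_bigr => -[k /= lt_k] _; congr (_ *: _).
elim: (size env) lt_k eq12 => //= m IHm; rewrite ltnS leq_eqVlt.
by case/predU1P=> [-> [] | /IHm{}IHm []].
Qed.

End ModuleReflection.

(* Atoms are compared up to conversion: the same product may be displayed along
   different paths of the algebraic hierarchy. *)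
Ltac module_index env x :=
  lazymatch env with
  | ?y :: ?env' =>
    match goal with
    | _ => let _ := match goal with _ => unify x y end in constr:(0%N)
    | _ => let k := module_index env' x in constr:(k.+1)
    end
  end.
Ltac module_atom env x :=
  match goal with
  | _ => let _ := module_index env x in env
  | _ => constr:(x :: env)
  end.
Ltac module_atoms env t :=
  lazymatch t with
  | 0 => env
  | ?a + ?b => let e := module_atoms env a in module_atoms e b
  | - ?a => module_atoms env a
  | _ *: ?a => module_atoms env a
  | _ => module_atom env t
  end.
Ltac module_reify R env t :=
  lazymatch t with
  | 0 => constr:(MZero R)
  | ?a + ?b => let a' := module_reify R env a in
               let b' := module_reify R env b in constr:(MAdd a' b')
  | - ?a => let a' := module_reify R env a in constr:(MOpp a')
  | ?k *: ?a => let a' := module_reify R env a in constr:(@MScale R k a')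
  | _ => let k := module_index env t in constr:(@MVar R k)
  end.
Ltac module R :=
  lazymatch goal with
  | |- @eq ?V ?x ?y =>
    let env0 := module_atoms (@nil V) x in
    let env := module_atoms env0 y in
    let ex := module_reify R env x in
    let ey := module_reify R env y in
    refine (@meval_eq R _ env ex ey _); cbn [mcoefs_eq mcoef size eqn];
    repeat split; ring
  end.

(** * The presentation *)

Section RelationMorphism.
Variables (F : fieldType) (n r : nat) (u : 'I_r.+1 -> F) (A B : lalgType F).
Variables (f : A -> B) (f1 : f 1 = 1) (f0 : f 0 = 0).
Hypotheses (fD : {morph f : x y / x + y}) (fB : {morph f : x y / x - y}).
Hypotheses (fM : {morph f : x y / x * y}) (fZ : forall a, {morph f : x / a *: x}).

Lemma lagrange_morph k x : f (lagrange u k x) = lagrange u k (f x).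
Proof.
rewrite /lagrange (big_morph f fM f1); apply: eq_bigr => l _.
by rewrite fZ fB fZ f1.
Qed.

(** Each relation is an identity between noncommutative polynomials in the generators, so it passes
    through a map that preserves the operations. The laws of [f] are separate hypotheses because
    [hpi] is a bare function. *)
Lemma hecke_relation_morph (T : 'I_n -> A) (xi : 'I_n.+1 -> A) :
    (forall x y, hecke_relation u T xi x y -> f x = f y) ->
  forall x y, hecke_relation u (f \o T) (f \o xi) x y -> x = y.
Proof.
move=> f_rel _ _ [i|i j ij|i j ij|j|i j|i|i|i j ij ij'] /=.
- by have := f_rel _ _ (rel_quad u _ _ i); rewrite fM fD f1 f0.
- by have := f_rel _ _ (rel_braid u _ _ ij); rewrite !fM.
- by have := f_rel _ _ (rel_TT u _ _ ij); rewrite !fM.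
- have := f_rel _ _ (rel_cyclotomic u _ _ j).
  rewrite (big_morph f fM f1) f0 => <-.
  by apply: eq_bigr => k _; rewrite fB fZ f1.
- by have := f_rel _ _ (rel_xixi u _ _ i j); rewrite !fM.
- have := f_rel _ _ (rel_Txi u _ _ i); rewrite fD !fM => ->.
  congr (_ + _); rewrite (big_morph f fD f0).
  apply: eq_bigr => a _; rewrite (big_morph f fD f0).
  by apply: eq_bigr => b _; rewrite fZ fM !lagrange_morph.
- by have := f_rel _ _ (rel_Txi_sum u _ _ i); rewrite !fM !fD.
- by have := f_rel _ _ (rel_Txi_far u _ _ ij ij'); rewrite !fM.
Qed.

End RelationMorphism.

Section HeckePresentation.
Variables (F : fieldType) (n r : nat) (u : 'I_r.+1 -> F).
Local Notation FA := (free_algebra F n).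
Local Notation H := (hecke n u).
Local Notation hpi := (@hpi F n r u).

Lemma hpi1 : hpi 1 = 1.
Proof. exact: erefl. Qed.

Lemma hpi0 : hpi 0 = 0.
Proof. by rewrite -(subrr 0) hpiB subrr. Qed.

Lemma hpiM : {morph hpi : x y / x * y}.
Proof. by move=> x y; rewrite -[RHS]/(hmul _ _) hmulE. Qed.

Lemma hpiZ a : {morph hpi : x / a *: x}.
Proof. by move=> x; rewrite -[RHS]/(hscale _ _) hscaleE. Qed.

Lemma hecke_relation_eq (x y : H) :
  hecke_relation u (hT u) (hxi u) x y -> x = y.
Proof.
apply: (hecke_relation_morph hpi1 hpi0 (@hpiD _ _ _ _) (@hpiB _ _ _ _) hpiM hpiZ).
by move=> a b ab; apply/hpiP; apply: mem_ideal_gen; exists a, b.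
Qed.

(** Words span the algebra, and each word arises from 1 by left multiplications by letters. *)
Lemma hecke_ind (P : H -> Prop) :
    P 1 -> (forall x y, P x -> P y -> P (x + y)) ->
    (forall a x, P x -> P (a *: x)) ->
    (forall i x, P x -> P (hT u i * x)) ->
    (forall j x, P x -> P (hxi u j * x)) ->
  forall x, P x.
Proof.
move=> P1 PD PZ PT Pxi x; have [y ->] := hpi_surj x.
rewrite [y]monalgE (big_morph hpi (@hpiD _ _ _ _) hpi0).
apply: (big_ind P) => [||k _]; [by rewrite -(scale0r 1); apply: PZ | exact: PD |].
have -> : << y@_k *g k >> = y@_k *: (<< 1 *g k >> : FA).
  by apply/malgP => k'; rewrite mcoeffZ !mcoeffU mulrnAr mulr1.
rewrite hpiZ; apply: PZ; case: k => s; elim: s => [|g s IHs].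
  by rewrite -fmoneE -[<< _ *g _ >>]/(1 : FA) hpi1.
have -> : << 1 *g FMonom (g :: s) >> = fgen F g * << 1 *g FMonom s >> :> FA.
  by rewrite /fgen malgM_def fgmulUU mulr1 /mmul /= fmmulE fmU.
rewrite hpiM; case: g => [i|j]; [exact: PT | exact: Pxi].
Qed.

End HeckePresentation.

(** * Color idempotents *)

Section ColorSwap.
Variables (n r : nat).
Local Notation color := {ffun 'I_n.+1 -> 'I_r.+1}.
Implicit Types (i : 'I_n) (c : color).

Definition swap_color (i : 'I_n) (c : color) : color :=
  [ffun k => c (tperm (pos i) (pos_next i) k)].

Lemma pos_neq_next (i : 'I_n) : pos i != pos_next i.
Proof. by rewrite -val_eqE /= /bump add1n neq_ltn ltnSn. Qed.

Lemma swap_color_pos i c : swap_color i c (pos i) = c (pos_next i).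
Proof. by rewrite ffunE tpermL. Qed.

Lemma swap_color_next i c : swap_color i c (pos_next i) = c (pos i).
Proof. by rewrite ffunE tpermR. Qed.

Lemma swap_color_far i c j : j != pos i -> j != pos_next i ->
  swap_color i c j = c j.
Proof. by move=> jp jn; rewrite ffunE tpermD // eq_sym. Qed.

Lemma swap_colorK i : involutive (swap_color i).
Proof. by move=> c; apply/ffunP => k; rewrite !ffunE tpermK. Qed.

Lemma swap_color_id i c : c (pos i) = c (pos_next i) -> swap_color i c = c.
Proof.
by move=> ci; apply/ffunP => k; rewrite ffunE; case: tpermP => // ->.
Qed.

(** Collects the effect of a product of Lagrange values, one for each position, into a single
    Kronecker delta. *)
Lemma color_eq_prod (R : comNzRingType) c c' :
  (c == c')%:R = \prod_(j < n.+1) (c j == c' j)%:R :> R.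
Proof.
have [->|/eqP cc'] := eqVneq c c'; first by rewrite big1 // => j _; rewrite eqxx.
have [j cj] : exists j, c j != c' j.
  apply/existsP; apply: contra_notT cc'; rewrite negb_exists => /forallP eq_cc'.
  by apply/ffunP => j; apply/eqP; have := eq_cc' j; rewrite negbK.
by rewrite (bigD1 j) //= (negPf cj) mul0r.
Qed.

End ColorSwap.

(** * Lagrange interpolation in an algebra *)

Section LagrangeInterpolation.
Variables (F : fieldType) (r : nat) (u : 'I_r.+1 -> F).
Hypothesis u_inj : injective u.

(** The value $P_k(u_b)$: for $b\ne k$ the factor with $l=b$ vanishes. *)
Lemma lagrange_scalar (k b : 'I_r.+1) :
  \prod_(l < r.+1 | l != k) ((u k - u l)^-1 * (u b - u l)) = (k == b)%:R.
Proof.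
have [->|kb] := eqVneq k b.
  apply: big1 => l lb; rewrite mulVf // subr_eq0.
  by apply: contra lb => /eqP/u_inj ->.
by rewrite (bigD1 b) 1?eq_sym //= subrr mulr0 mul0r.
Qed.

(** The correction in the relation for $T_i\xi_i$ at colors [x], [y]: of all pairs $a<b$ only
    $(x,y)$ can contribute. *)
Lemma sum_lt_delta (x y : 'I_r.+1) :
  \sum_(a < r.+1) \sum_(b < r.+1 | (a < b)%N)
     (u b - u a) * ((a == x)%:R * (b == y)%:R) = (x < y)%N%:R * (u y - u x).
Proof.
rewrite (bigD1 x) //= [X in _ + X]big1 ?addr0; last first.
  by move=> a /negPf ax; rewrite big1 // => b _; rewrite ax mul0r mulr0.
rewrite big_mkcond (bigD1 y) //= [X in _ + X]big1 ?addr0; last first.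
  by move=> b /negPf by_; case: ifP => // _; rewrite by_ !mulr0.
by case: ifP; rewrite ?mul0r // !eqxx !mulr1 mul1r.
Qed.

Lemma lagrange_eigen (A : algType F) (x w : A) k b :
  x * w = u b *: w -> lagrange u k x * w = (k == b)%:R *: w.
Proof.
move=> xw; rewrite -(lagrange_scalar k b) /lagrange.
apply: (big_rec2 (fun p q => p * w = q *: w)) => [|l p q _ IH].
  by rewrite mul1r scale1r.
rewrite -[LHS]mulrA IH -scalerAr -scalerAl mulrBl xw -scalerAl mul1r.
by rewrite -scalerBl !scalerA; congr (_ *: _); ring.
Qed.

Lemma lagrange_polyE k b : (lagrange u k ('X : {poly F})).[u b] = (k == b)%:R.
Proof.
rewrite -lagrange_scalar /lagrange horner_prod; apply: eq_bigr => l _.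
by rewrite hornerZ hornerD hornerX hornerN hornerZ hornerC mulr1.
Qed.

Lemma size_lagrange_poly k : (size (lagrange u k ('X : {poly F})) <= r.+1)%N.
Proof.
rewrite /lagrange scaler_prod; apply: leq_trans (size_scale_leq _ _) _.
under eq_bigr => l _ do rewrite alg_polyC.
rewrite -big_filter size_prod_XsubC size_filter; set s := index_enum _.
have : (count (predC (pred1 k)) s + count (pred1 k) s = r.+1)%N.
  by rewrite addnC count_predC /s -[RHS]card_ord cardT enumT.
have -> : count (pred1 k) s = 1%N.
  by rewrite (count_uniq_mem _ (index_enum_uniq _)) mem_index_enum.
by rewrite addn1 => ->.
Qed.

(** The difference of the two sides has degree at most [r] and vanishes at the [r.+1] distinct
    points $u_b$. *)
Lemma sum_lagrange_poly : \sum_k lagrange u k ('X : {poly F}) = 1.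
Proof.
apply/eqP; rewrite -subr_eq0; apply/eqP.
apply: (@roots_geq_poly_eq0 F _ [seq u b | b <- enum 'I_r.+1]).
- apply/allP => _ /mapP[b _ ->]; rewrite rootE hornerD hornerN hornerC.
  rewrite horner_sum (bigD1 b) //= lagrange_polyE eqxx big1 ?addr0 ?subrr //.
  by move=> k kb; rewrite lagrange_polyE (negPf kb).
- by rewrite map_inj_uniq ?enum_uniq.
- rewrite size_map size_enum_ord.
  apply: leq_trans (size_polyD _ _) _; rewrite geq_max size_polyN size_poly1 andbT.
  apply: (leq_trans (size_sum _ _ _)); apply/bigmax_leqP => k _.
  exact: size_lagrange_poly.
Qed.

Variables (A : algType F) (x : A).

Lemma horner_lagrange k : horner_alg x (lagrange u k 'X) = lagrange u k x.
Proof.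
rewrite (lagrange_morph u (rmorph1 (horner_alg x)) (rmorphB _) (rmorphM _)).
  by rewrite /= horner_algX.
by move=> a p; rewrite -mul_polyC rmorphM /= horner_algC mulr_algl.
Qed.

Lemma sum_lagrange : \sum_k lagrange u k x = 1.
Proof.
under eq_bigr => k _ do rewrite -horner_lagrange.
by rewrite -rmorph_sum /= sum_lagrange_poly rmorph1.
Qed.

(** $(X-u_k)P_k$ is a scalar multiple of $\prod_l(X-u_l)$, which vanishes at [x]. *)
Lemma mul_lagrange k : \prod_(l < r.+1) (x - (u l)%:A) = 0 ->
  x * lagrange u k x = u k *: lagrange u k x.
Proof.
move=> x0; apply/eqP; rewrite -subr_eq0 -[u k *: _]mul1r -scalerAr scalerAl -mulrBl.
have -> : x - u k *: 1 = horner_alg x ('X - (u k)%:P).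
  by rewrite rmorphB /= horner_algX horner_algC.
rewrite -horner_lagrange -rmorphM /= /lagrange scaler_prod -scalerAr.
have -> : ('X - (u k)%:P) * \prod_(l < r.+1 | l != k) ('X - (u l)%:A)
          = \prod_(l < r.+1) ('X - (u l)%:A) :> {poly F}.
  by rewrite [RHS](bigD1 k) //= alg_polyC.
rewrite linearZ /= rmorph_prod /=.
rewrite (eq_bigr (fun l => x - (u l)%:A)) ?x0 ?mulr0 // => l _.
by rewrite rmorphB /= horner_algX alg_polyC horner_algC.
Qed.

End LagrangeInterpolation.

(** * Commutation of the $T_i$ with the color idempotents *)

Section HeckeAlgebra.
Variables (F : fieldType) (n r : nat) (u : 'I_r.+1 -> F).
Hypothesis u_inj : injective u.
Variables (A : algType F) (T : 'I_n -> A) (xi : 'I_n.+1 -> A).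
Hypothesis rel : forall x y, hecke_relation u T xi x y -> x = y.
Local Notation color := {ffun 'I_n.+1 -> 'I_r.+1}.
Implicit Types (i : 'I_n) (c : color).

Definition color_eigen c (w : A) := forall j, xi j * w = u (c j) *: w.

(** The product [color_idempotent], in any algebra whose elements [T] and [xi] satisfy the
    relations. *)
Definition color_idem c := \prod_(j < n.+1) lagrange u (c j) (xi j).

Lemma xi_lagrange_comm j j' k :
  xi j * lagrange u k (xi j') = lagrange u k (xi j') * xi j.
Proof.
apply: commr_prod => l _; rewrite /GRing.comm -scalerAr -scalerAl.
congr (_ *: _); rewrite mulrBl mulrBr -scalerAr -scalerAl mulr1 mul1r.
by rewrite (rel (rel_xixi u T xi j j')).
Qed.

(** The factor at position [j] turns $\xi_j$ into the scalar $u_{c_j}$, and $\xi_j$ commutes past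
    the factors before it. *)
Lemma color_idem_eigen c : color_eigen c (color_idem c).
Proof.
move=> j; rewrite /color_idem.
have : j \in index_enum 'I_n.+1 by rewrite mem_index_enum.
elim: (index_enum _) => // j' s IHs; rewrite big_cons inE.
have [<- _|_ /= /IHs eq_s] := eqVneq j j'.
  by rewrite mulrA mul_lagrange ?scalerAl // (rel (rel_cyclotomic u T xi j)).
by rewrite mulrA xi_lagrange_comm -mulrA eq_s scalerAr.
Qed.

Lemma color_idem_mul c c' w : color_eigen c' w ->
  color_idem c * w = (c == c')%:R *: w.
Proof.
move=> wP; rewrite color_eq_prod.
apply: (big_rec2 (fun p q => p * w = q *: w)) => [|j p q _ IH].
  by rewrite mul1r scale1r.
by rewrite -[LHS]mulrA IH -scalerAr (lagrange_eigen u_inj _ (wP j)) scalerA mulrC.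
Qed.

(** Expand $\prod_j\sum_kP_k(\xi_j)$, each of whose factors is 1. *)
Lemma sum_color_idem : \sum_c color_idem c = 1.
Proof.
rewrite -(bigA_distr_bigA (fun j k => lagrange u k (xi j))).
by rewrite big1 // => j _; rewrite sum_lagrange.
Qed.

Lemma rel_Txi_eigen i c w : color_eigen c w ->
  (\sum_(a < r.+1) \sum_(b < r.+1 | (a < b)%N)
     (u b - u a) *: (lagrange u a (xi (pos i)) * lagrange u b (xi (pos_next i)))) * w
  = ((c (pos i) < c (pos_next i))%N%:R * (u (c (pos_next i)) - u (c (pos i)))) *: w.
Proof.
move=> wP; have term a b : (u b - u a) *: (lagrange u a (xi (pos i)) *
      lagrange u b (xi (pos_next i))) * w
    = ((u b - u a) * ((a == c (pos i))%:R * (b == c (pos_next i))%:R)) *: w.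
  rewrite -scalerAl -mulrA (lagrange_eigen u_inj _ (wP _)) -scalerAr.
  by rewrite (lagrange_eigen u_inj _ (wP _)) !scalerA -mulrA [in RHS](mulrC (_ == _)%:R).
rewrite -sum_lt_delta scaler_suml mulr_suml; apply: eq_bigr => a _.
by rewrite scaler_suml mulr_suml; apply: eq_bigr => b _; apply: term.
Qed.

(** The element $T_i+[c_i<c_{i+1}]$ maps color $c$ to color $s_ic$. The relation for $T_i\xi_i$
    gives the eigenvalue of $\xi_{i+1}$; that of $\xi_i$ follows because $\xi_i+\xi_{i+1}$ commutes
    with $T_i$. *)
Lemma swap_color_eigen i c w : color_eigen c w ->
  color_eigen (swap_color i c)
              (T i * w + (c (pos i) < c (pos_next i))%N%:R *: w).
Proof.
move=> wP j; have [x_p y_p] := (wP (pos i), wP (pos_next i)).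
have xT : xi (pos_next i) * (T i * w) = u (c (pos i)) *: (T i * w)
    - ((c (pos i) < c (pos_next i))%N%:R * (u (c (pos_next i)) - u (c (pos i)))) *: w.
  rewrite -rel_Txi_eigen // scalerAr -x_p [in RHS]mulrA (rel (rel_Txi u T xi i)).
  by rewrite mulrDl addrK mulrA.
have [->|jp] := eqVneq j (pos i); last have [->|jn] := eqVneq j (pos_next i).
- have := congr1 (fun z => z * w) (rel (rel_Txi_sum u T xi i)).
  rewrite -mulrA mulrDl x_p y_p -mulrA mulrDl xT mulrDr -!scalerAr.
  move/(canLR (addrK _)) => yT; rewrite swap_color_pos mulrDr -scalerAr x_p -yT.
  module F.
- rewrite swap_color_next mulrDr xT -scalerAr y_p; module F.
- rewrite swap_color_far // mulrDr -scalerAr wP mulrA.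
  rewrite -(rel (rel_Txi_far u T xi jp jn)) -mulrA wP -scalerAr; module F.
Qed.

(** Multiplying $L_{s_ic}T_i$ on the right by $1=\sum_{c''}L_{c''}$ leaves only contributions from
    $c''=c$ and $c''=s_ic$. *)
Lemma T_color_idem i c :
  T i * color_idem c = color_idem (swap_color i c) * T i
    + (c (pos_next i) < c (pos i))%N%:R *: color_idem (swap_color i c)
    - (c (pos i) < c (pos_next i))%N%:R *: color_idem c.
Proof.
set c' := swap_color i c.
(* $T_iL_{c''}$ is an eigenvector of color $s_ic''$ minus a multiple of $L_{c''}$, and $L_{c'}$
   keeps only matching colors. *)
have term c'' : color_idem c' * T i * color_idem c'' =
    (c == c'')%:R *: (T i * color_idem c''
       + (c'' (pos i) < c'' (pos_next i))%N%:R *: color_idem c'')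
    - (c'' (pos i) < c'' (pos_next i))%N%:R *: ((c' == c'')%:R *: color_idem c'').
  rewrite -(color_idem_mul _ (color_idem_eigen c'')).
  have -> : (c == c'')%:R = (c' == swap_color i c'')%:R :> F.
    by rewrite /c' (can_eq (@swap_colorK n r i)).
  rewrite -(color_idem_mul _ (swap_color_eigen i (color_idem_eigen c''))).
  by rewrite mulrDr -scalerAr addrK mulrA.
have -> : color_idem c' * T i = T i * color_idem c
    + (c (pos i) < c (pos_next i))%N%:R *: color_idem c
    - (c' (pos i) < c' (pos_next i))%N%:R *: color_idem c'.
  rewrite -[LHS]mulr1 -sum_color_idem mulr_sumr (eq_bigr _ (fun c'' _ => term c'')).
  rewrite sumrB (bigD1 c) //= eqxx scale1r; congr (_ - _).
    by rewrite big1 ?addr0 // => c''; rewrite eq_sym => /negPf->; rewrite scale0r.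
  rewrite (bigD1 c') //= eqxx scale1r big1 ?addr0 // => c''.
  by rewrite eq_sym => /negPf->; rewrite scale0r scaler0.
rewrite swap_color_pos swap_color_next; module F.
Qed.

End HeckeAlgebra.

(** * The action on functions of colors *)

Section DemazureOperators.
Variables (F : fieldType) (A : algType F) (X : Type).

(* The coefficients of [T_i (sum_c L_c f c)], by the rule for moving [T_i] past
   [L_c]; [d] holds at [c] when [c_i < c_(i+1)], and [s] swaps these two colors. *)
Definition demazure (t : A) (s : X -> X) (d : pred X) (f : X -> A) (c : X) : A :=
  t * f (s c) - (d c)%:R *: (f c - f (s c)).

Lemma demazureD t s d f g c :
  demazure t s d (fun c => f c + g c) c = demazure t s d f c + demazure t s d g c.
Proof. by rewrite /demazure mulrDr; module F. Qed.

(** A case analysis on the order of the two swapped colors [a c] and [b c]; when they are equal, [s]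
    fixes [c]. *)
Lemma demazure_quad t s (a b : X -> nat) f c :
    t * t = - t -> involutive s -> (forall c, a (s c) = b c) ->
    (forall c, b (s c) = a c) -> (forall c, a c = b c -> s c = c) ->
  let D := demazure t s (fun c => a c < b c)%N in
  D (D f) c = - D f c.
Proof.
move=> tt sK as_ bs s_id D; rewrite /D /demazure !sK as_ bs.
have ttK w : t * (t * w) = - (t * w) by rewrite mulrA tt mulNr.
case: (ltngtP (a c) (b c)) => [_|_|ab]; last rewrite (s_id _ ab);
  rewrite ?scale0r ?scale1r ?subr0 ?(mulrDr, mulrN) ?ttK; module F.
Qed.

Lemma demazure_comm t1 t2 s1 s2 (d1 d2 : pred X) f c :
    t1 * t2 = t2 * t1 -> (forall c, s1 (s2 c) = s2 (s1 c)) ->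
    (forall c, d1 (s2 c) = d1 c) -> (forall c, d2 (s1 c) = d2 c) ->
  demazure t1 s1 d1 (demazure t2 s2 d2 f) c =
  demazure t2 s2 d2 (demazure t1 s1 d1 f) c.
Proof.
move=> tC sC d1s2 d2s1; rewrite /demazure !sC !d1s2 !d2s1.
have tCw w : t1 * (t2 * w) = t2 * (t1 * w) by rewrite !mulrA tC.
by rewrite !(mulrDr, mulrN, =^~ scalerAr) tCw; module F.
Qed.

Section Braid.
Variables (t1 t2 : A) (s1 s2 : X -> X) (x y z : X -> nat).
Hypotheses (t1Q : t1 * t1 = - t1) (t2Q : t2 * t2 = - t2).
Hypothesis tB : t1 * t2 * t1 = t2 * t1 * t2.
Hypotheses (s1K : involutive s1) (s2K : involutive s2).
Hypothesis sB : forall c, s1 (s2 (s1 c)) = s2 (s1 (s2 c)).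
Hypotheses (x1 : forall c, x (s1 c) = y c) (y1 : forall c, y (s1 c) = x c).
Hypotheses (z1 : forall c, z (s1 c) = z c) (x2 : forall c, x (s2 c) = x c).
Hypotheses (y2 : forall c, y (s2 c) = z c) (z2 : forall c, z (s2 c) = y c).
Hypothesis s1_id : forall c, x c = y c -> s1 c = c.
Hypothesis s2_id : forall c, y c = z c -> s2 c = c.

(** [x], [y], [z] are the colors at three consecutive positions. For each weak order of the three,
    the quadratic and braid relations reduce the claim to a linear identity. *)
Lemma demazure_braid f c :
  let D1 := demazure t1 s1 (fun c => x c < y c)%N in
  let D2 := demazure t2 s2 (fun c => y c < z c)%N in
  D1 (D2 (D1 f)) c = D2 (D1 (D2 f)) c.
Proof.
move=> D1 D2; rewrite /D1 /D2 /demazure; pose colE := (x1, y1, z1, x2, y2, z2).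
have q1 w : t1 * (t1 * w) = - (t1 * w) by rewrite mulrA t1Q mulNr.
have q2 w : t2 * (t2 * w) = - (t2 * w) by rewrite mulrA t2Q mulNr.
have b w : t1 * (t2 * (t1 * w)) = t2 * (t1 * (t2 * w)).
  by rewrite !mulrA tB.
rewrite !(colE, sB, s1K, s2K).
case: (ltngtP (x c) (y c)) => xy; case: (ltngtP (y c) (z c)) => yz;
  case: (ltngtP (x c) (z c)) => xz; try by exfalso; lia.
all: try have s1c := s1_id xy.
all: try have s2c := s2_id yz.
all: rewrite ?scale0r ?scale1r ?subr0 ?s1c ?s2c ?s1c ?s2c.
(* If [x c = z c], the first swap brings the two equal colors together and the second one does
   nothing. *)
all: try have s12c : s1 (s2 c) = s2 c by rewrite s1_id // !colE.
all: try have s21c : s2 (s1 c) = s1 c by rewrite s2_id // !colE.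
all: rewrite ?s12c ?s21c ?s12c ?s21c ?s1K ?s2K.
all: rewrite ?(mulrDr, mulrN, b, q1, q2).
all: module F.
Qed.
End Braid.
End DemazureOperators.

(** * Linear operators defined by noncommutative polynomials *)

Section FreeAction.
Variables (F : fieldType) (I : choiceType) (V : lmodType F).
Variables (g : I -> {linear V -> V}).
Local Notation FA := {malg F[{fmonom I}]}.

(** The first letter of a word acts last, so that products act by composition. *)
Definition word_act (s : seq I) (v : V) : V := foldr (fun a => g a) v s.

Definition free_act (x : FA) (v : V) : V :=
  \sum_(k <- msupp x) x@_k *: word_act k v.

Lemma word_act_cat s t v : word_act (s ++ t) v = word_act s (word_act t v).
Proof. exact: foldr_cat. Qed.

Lemma word_act_linear s : linear (word_act s).
Proof. by move=> a v w; elim: s => //= b s ->; rewrite linearP. Qed.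

HB.instance Definition _ s :=
  GRing.isLinear.Build F V V *:%R (word_act s) (word_act_linear s).

(** Elements with different supports can then be summed over a common index set. *)
Lemma free_actEw (d : {fset {fmonom I}}) x v : (msupp x `<=` d)%fset ->
  free_act x v = \sum_(k <- d) x@_k *: word_act k v.
Proof.
move=> le; rewrite [LHS](big_fset_incl _ le) => //= k kd /mcoeff_outdom ->.
by rewrite scale0r.
Qed.

Lemma free_actB x y v : free_act (x - y) v = free_act x v - free_act y v.
Proof.
rewrite (free_actEw _ (msuppB_le _ _)) (free_actEw _ (fsubsetUl _ (msupp y))).
rewrite (free_actEw _ (fsubsetUr (msupp x) _)) -sumrB.
by apply/eq_bigr => k _; rewrite mcoeffB scalerBl.
Qed.

Lemma free_act0 v : free_act 0 v = 0.
Proof. by rewrite -(subrr 0) free_actB subrr. Qed.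

Lemma free_actD x y v : free_act (x + y) v = free_act x v + free_act y v.
Proof.
by rewrite -{1}[y]opprK free_actB -[- y]sub0r free_actB free_act0 sub0r opprK.
Qed.

Lemma free_act_sum (J : Type) (s : seq J) (f : J -> FA) v :
  free_act (\sum_(k <- s) f k) v = \sum_(k <- s) free_act (f k) v.
Proof.
exact: (big_morph (free_act^~ v) (fun x y => free_actD x y v) (free_act0 v)).
Qed.

Lemma free_actZ a x v : free_act (a *: x) v = a *: free_act x v.
Proof.
rewrite (free_actEw _ (msuppZ_le _ _)) /free_act scaler_sumr.
by apply/eq_bigr => k _; rewrite mcoeffZ scalerA.
Qed.

Lemma free_actU a k v : free_act << a *g k >> v = a *: word_act k v.
Proof. by rewrite (free_actEw _ (msuppU_le)) big_seq_fset1 mcoeffUU. Qed.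

Lemma free_act_gen b v : free_act << 1 *g fmu b >> v = g b v.
Proof. by rewrite free_actU scale1r fmU. Qed.

Lemma free_act1 v : free_act 1 v = v.
Proof. by rewrite free_actU scale1r fm1. Qed.

Lemma free_actM x y v : free_act (x * y) v = free_act x (free_act y v).
Proof.
rewrite malgME free_act_sum [RHS]/free_act; apply/eq_bigr => k _.
rewrite free_act_sum {2}/free_act linear_sum scaler_sumr; apply: eq_bigr => l _.
by rewrite free_actU fmM word_act_cat linearZ scalerA.
Qed.

Lemma free_act_vB x v w : free_act x (v - w) = free_act x v - free_act x w.
Proof.
by rewrite -sumrB; apply: eq_bigr => k _; rewrite linearB scalerBr.
Qed.

End FreeAction.

(** * The defining relations on functions of colors *)

Section ColorModule.
Variables (F : fieldType) (n r : nat) (u : 'I_r.+1 -> F).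
Hypothesis u_inj : injective u.
Variables (A : algType F) (T : 'I_n -> A) (xi : 'I_n.+1 -> A).
Hypothesis rel : forall x y, hecke_relation u T xi x y -> x = y.
Local Notation color := {ffun 'I_n.+1 -> 'I_r.+1}.
Local Notation V := {ffun color -> A}.
Implicit Types (i : 'I_n) (c : color).

(** A function [f] stands for the formal sum $\sum_cL_cf(c)$, with the $L_c$ treated as
    independent. *)
Definition color_T i (f : V) : V :=
  [ffun c : color => demazure (T i) (swap_color i)
               (fun c : color => c (pos i) < c (pos_next i))%N f c].

Definition color_xi (j : 'I_n.+1) (f : V) : V := [ffun c : color => u (c j) *: f c].

Definition color_gen (g : 'I_n + 'I_n.+1) : V -> V :=
  match g with inl i => color_T i | inr j => color_xi j end.

Lemma color_gen_linear g : linear (color_gen g).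
Proof.
move=> a f h; apply/ffunP => c; case: g => [i|j]; rewrite !ffunE; last by module F.
by rewrite /demazure !ffunE mulrDr -scalerAr; module F.
Qed.

HB.instance Definition _ g :=
  GRing.isLinear.Build F V V *:%R (color_gen g) (color_gen_linear g).

Lemma swap_color_braid (i j : 'I_n) c : j = i.+1 :> nat ->
  swap_color i (swap_color j (swap_color i c)) =
  swap_color j (swap_color i (swap_color j c)).
Proof.
move=> ij; have pij : pos_next i = pos j by apply: val_inj; rewrite /= /bump ij.
have d1 : pos i != pos_next j by rewrite -val_eqE /= /bump ij; lia.
have d0 := pos_neq_next i; have d2 := pos_neq_next j.
have braid (a b d : 'I_n.+1) : a != b -> b != d -> a != d ->
    (tperm a b * tperm b d * tperm a b = tperm b d * tperm a b * tperm b d)%g.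
  (* Both sides are conjugates of a transposition, equal to the transposition of [a] and [d]. *)
  move=> ab bd ad; transitivity (tperm a d).
    by rewrite -{1}[tperm a b]tpermV -mulgA -/(conjg _ _) tpermJ tpermR tpermD.
  by rewrite -{1}[tperm b d]tpermV -mulgA -/(conjg _ _) tpermJ tpermL tpermD 1?eq_sym.
apply/ffunP => k; rewrite !ffunE; congr (c _).
by rewrite -!permM pij !mulgA braid // -pij.
Qed.

Lemma swap_color_comm (i j : 'I_n) c : (i.+2 <= j)%N || (j.+2 <= i)%N ->
  swap_color i (swap_color j c) = swap_color j (swap_color i c).
Proof.
move=> ij; have [pp pn np nn] : [/\ pos i != pos j, pos i != pos_next j,
    pos_next i != pos j & pos_next i != pos_next j].
  by rewrite -!val_eqE /= /bump; split; lia.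
apply/ffunP => k; rewrite !ffunE; congr (c _).
rewrite -!permM; congr (fun_of_perm _ k).
apply/commgP/conjg_fixP; rewrite tpermJ !tpermD // eq_sym //.
Qed.

Section Relations.
Variables (B : lalgType F) (act : B -> V -> V).
Variables (T0 : 'I_n -> B) (xi0 : 'I_n.+1 -> B).
Hypothesis act0 : forall f, act 0 f = 0.
Hypothesis act1 : forall f, act 1 f = f.
Hypothesis actD : forall x y f, act (x + y) f = act x f + act y f.
Hypothesis actB : forall x y f, act (x - y) f = act x f - act y f.
Hypothesis actM : forall x y f, act (x * y) f = act x (act y f).
Hypothesis actZ : forall a x f, act (a *: x) f = a *: act x f.
Hypothesis actT : forall i f, act (T0 i) f = color_T i f.
Hypothesis actxi : forall j f, act (xi0 j) f = color_xi j f.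

Lemma act_lagrange k j f c :
  act (lagrange u k (xi0 j)) f c = (k == c j)%:R *: f c.
Proof.
rewrite -(lagrange_scalar u_inj) /lagrange; move: f.
apply: (big_rec2 (fun p q => forall f, act p f c = q *: f c)) => [|l p q _ IH] f.
  by rewrite act1 scale1r.
by rewrite actM actZ actB actxi actZ act1 !ffunE IH; module F.
Qed.

(** So $L_{c_0}$ acts as the projection onto functions supported at [c0]. *)
Lemma act_color_idem c0 f c :
  act (\prod_(j < n.+1) lagrange u (c0 j) (xi0 j)) f c = (c0 == c)%:R *: f c.
Proof.
rewrite color_eq_prod; move: f.
apply: (big_rec2 (fun p q => forall f, act p f c = q *: f c)) => [|l p q _ IH] f.
  by rewrite act1 scale1r.
by rewrite actM act_lagrange IH scalerA.
Qed.

(** On a constant function the difference term of [demazure] vanishes. *)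
Lemma act_const i a : act (T0 i) [ffun=> a] = [ffun=> T i * a].
Proof.
by apply/ffunP => c; rewrite actT !ffunE /demazure !ffunE subrr scaler0 subr0.
Qed.

(** The relations among the $T_i$ come from the identities for [demazure], those among the $\xi_j$
    from their acting by scalars at each color; the mixed ones are pointwise computations. The
    relations are not assumed in [B], which will be the free algebra. *)
Lemma act_hecke_relation x y f :
  hecke_relation u T0 xi0 x y -> act x f = act y f.
Proof.
have TQ i : T i * T i = - T i.
  apply/eqP; rewrite -addr_eq0 -{3}[T i]mulr1 -mulrDr.
  by rewrite (rel (rel_quad u T xi i)).
have sw_id i c (eq_c : c (pos i) = c (pos_next i) :> nat) : swap_color i c = c.
  exact/swap_color_id/val_inj.
(* An equality of plain functions, so that nested operators become nested [demazure]. *)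
have TE i f' : (color_T i f' : color -> A) = demazure (T i) (swap_color i)
    (fun c : color => (c (pos i) < c (pos_next i))%N) f'.
  by apply/funext => c; rewrite ffunE.
have swp i c : swap_color i c (pos i) = c (pos_next i) :> nat.
  by rewrite swap_color_pos.
have swn i c : swap_color i c (pos_next i) = c (pos i) :> nat.
  by rewrite swap_color_next.
have swf i c j : j != pos i -> j != pos_next i -> swap_color i c j = c j :> nat.
  by move=> ? ?; rewrite swap_color_far.
case=> [i|i j ij|i j ij|j|i j|i|i|i j ij ij']; apply/ffunP => c;
  rewrite ?(actM, actD, act0, act1, actT, actxi).
- rewrite [RHS]ffunE TE.
  have -> : (color_T i f + f : color -> A) = fun c' => color_T i f c' + f c'.
    by apply/funext => c'; rewrite ffunE.
  have := @demazure_quad F A color (T i) (swap_color i) (fun c => c (pos i))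
    (fun c => c (pos_next i)) f c (TQ i) (@swap_colorK n r i) (swp i) (swn i) (sw_id i).
  by rewrite demazureD !TE => /= ->; rewrite addNr.
- have nij : pos_next i = pos j by apply: val_inj; rewrite /= /bump ij.
  have [d1 d2] : pos_next j != pos i /\ pos_next j != pos_next i.
    by rewrite -!val_eqE /= /bump ij; split; lia.
  have [d3 d4] : pos i != pos j /\ pos i != pos_next j.
    by rewrite -!val_eqE /= /bump ij; split; lia.
  rewrite !TE nij.
  apply: (@demazure_braid F A color _ _ _ _ (fun c => c (pos i)) (fun c => c (pos j))
           (fun c => c (pos_next j)) (TQ i) (TQ j) (rel (rel_braid u T xi ij))
           (@swap_colorK n r i) (@swap_colorK n r j)) => [c'|c'|c'|c'|c'|c'|c'|c'|c'].
  + exact: swap_color_braid.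
  + by rewrite -nij swp.
  + by rewrite -nij swn.
  + by rewrite swf.
  + by rewrite swf.
  + exact: swp.
  + exact: swn.
  + by rewrite -nij; apply: sw_id.
  + exact: sw_id.
- rewrite !TE; have [pp pn np nn] : [/\ pos i != pos j, pos i != pos_next j,
      pos_next i != pos j & pos_next i != pos_next j].
    by rewrite -!val_eqE /= /bump; split; lia.
  apply: demazure_comm (rel (rel_TT u T xi ij)) _ _ _ => c'.
  + exact: swap_color_comm.
  + by rewrite !swf.
  + by rewrite !swf // eq_sym.
- have -> : act (\prod_(k < r.+1) (xi0 j - (u k)%:A)) f c
      = (\prod_(k < r.+1) (u (c j) - u k)) *: f c.
    move: f; apply: (big_rec2 (fun p q => forall f, act p f c = q *: f c)).
      by move=> f; rewrite act1 scale1r.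
    move=> l p q _ IH f.
    by rewrite actM actB actxi actZ act1 !ffunE IH; module F.
  by rewrite (bigD1 (c j)) //= subrr mul0r scale0r ffunE.
- by rewrite !ffunE; module F.
- rewrite [RHS]ffunE.
  have -> : act (\sum_(a < r.+1) \sum_(b < r.+1 | (a < b)%N) (u b - u a) *:
       (lagrange u a (xi0 (pos i)) * lagrange u b (xi0 (pos_next i)))) f c
     = ((c (pos i) < c (pos_next i))%N%:R *
          (u (c (pos_next i)) - u (c (pos i)))) *: f c.
    rewrite -sum_lt_delta (big_morph (act^~ f) (fun x y => actD x y f) (act0 f)).
    rewrite sum_ffunE scaler_suml; apply: eq_bigr => a _.
    rewrite (big_morph (act^~ f) (fun x y => actD x y f) (act0 f)).
    rewrite sum_ffunE scaler_suml; apply: eq_bigr => b _.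
    by rewrite actZ ffunE actM !act_lagrange !scalerA mulrA.
  rewrite !ffunE /demazure !ffunE tpermL -!scalerAr; module F.
- rewrite !ffunE /demazure !ffunE tpermL tpermR mulrDr -!scalerAr; module F.
- by rewrite !ffunE /demazure !ffunE tpermD 1?eq_sym // -!scalerAr; module F.
Qed.

End Relations.
End ColorModule.

Lemma const_ffun_linear (F : fieldType) (A : algType F) (X : finType)
    (a : F) (x y b : A) :
  [ffun=> (a *: x + y) * b] = a *: [ffun=> x * b] + [ffun=> y * b]
    :> {ffun X -> A}.
Proof. by apply/ffunP => c; rewrite !ffunE mulrDl scalerAl. Qed.

(** * Nonvanishing of $L_{\mathbf c}\eta_I$ *)

Section Nonvanishing.
Variables (F : fieldType) (n r : nat) (u : 'I_r.+1 -> F).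
Hypothesis u_inj : injective u.
Local Notation H := (hecke n u).
Local Notation FA := (free_algebra F n).
Local Notation color := {ffun 'I_n.+1 -> 'I_r.+1}.
Local Notation V := {ffun color -> H}.

(** Functions take values in the algebra itself, so an element of $H_n(0)$ can be read off from its
    action on the constant function 1. *)
Definition color_act : FA -> V -> V :=
  free_act (fun g => color_gen u (hT u) g : {linear V -> V}).

Lemma color_actD x y f : color_act (x + y) f = color_act x f + color_act y f.
Proof. exact: free_actD. Qed.

Lemma color_actB x y f : color_act (x - y) f = color_act x f - color_act y f.
Proof. exact: free_actB. Qed.

Lemma color_actM x y f : color_act (x * y) f = color_act x (color_act y f).
Proof. exact: free_actM. Qed.

Lemma color_actZ a x f : color_act (a *: x) f = a *: color_act x f.
Proof. exact: free_actZ. Qed.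

Lemma color_act0 f : color_act 0 f = 0.
Proof. exact: free_act0. Qed.

Lemma color_act1 f : color_act 1 f = f.
Proof. exact: free_act1. Qed.

Lemma color_actv0 x : color_act x 0 = 0.
Proof. by rewrite -[0 in LHS](subrr 0) /color_act free_act_vB subrr. Qed.

Lemma color_act_T i f : color_act (fT F i) f = color_T (hT u) i f.
Proof. exact: free_act_gen. Qed.

Lemma color_act_xi j f : color_act (fxi F j) f = color_xi u j f.
Proof. exact: free_act_gen. Qed.

(** The elements acting by zero form a two-sided ideal that contains the defining relations. *)
Lemma color_act_ideal x : x \in @hecke_ideal F n r u -> forall f, color_act x f = 0.
Proof.
move=> /ideal_genP xJ.
have /xJ h : two_sided_ideal (fun y => `[< forall f, color_act y f = 0 >] : bool).
  split.
  - split; first by apply/asboolP => f; apply: color_act0.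
    move=> y z /asboolP y0 /asboolP z0; apply/asboolP => f.
    by rewrite color_actB y0 z0 subr0.
  - move=> a y /asboolP y0; apply/asboolP => f.
    by rewrite color_actM y0 color_actv0.
  - by move=> a y /asboolP y0; apply/asboolP => f; rewrite color_actM y0.
apply/asboolP; apply: h => _ [y [z [yz ->]]]; apply/asboolP => f.
rewrite color_actB; apply/eqP; rewrite subr_eq0; apply/eqP.
exact: (act_hecke_relation u_inj (@hecke_relation_eq F n r u) color_act0
  color_act1 color_actD color_actB color_actM color_actZ color_act_T
  color_act_xi f yz).
Qed.

Lemma color_act_hpi x y f : hpi u x = hpi u y -> color_act x f = color_act y f.
Proof.
move=> /hpiP /color_act_ideal /(_ f) xy0; apply/eqP.
by rewrite -subr_eq0 -color_actB xy0.
Qed.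

(** The elements for which this holds, with every representative in the free algebra, form a
    subalgebra containing the $T_i$. *)
Lemma color_act_hecke0 (h : H) x m : in_hecke0 h -> hpi u x = h ->
  color_act x [ffun=> m] = [ffun=> h * m].
Proof.
move=> h0; pose B : {pred H} := fun h' => `[< forall x m, hpi u x = h' ->
  color_act x [ffun=> m] = [ffun=> h' * m] >].
suff hB : subalg_closed B.
  have /asboolP h_act : h \in B; last exact: h_act.
  apply: h0 hB _ => i; apply/asboolP => y a /(@color_act_hpi y (fT F i)) ->.
  exact: (act_const color_act_T).
split.
- apply/asboolP => y a /(@color_act_hpi y 1) ->.
  by rewrite color_act1 (mul1r a).
- move=> a h1 h2 /asboolP act1 /asboolP act2; apply/asboolP => y b hy.
  have [[y1 e1] [y2 e2]] := (hpi_surj h1, hpi_surj h2).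
  have /color_act_hpi -> : hpi u y = hpi u (a *: y1 + y2).
    by rewrite hy e1 e2 (hpiD u (a *: y1)) (hpiZ u a y1).
  rewrite color_actD color_actZ (act1 y1 b (esym e1)) (act2 y2 b (esym e2)).
  exact: esym (const_ffun_linear _ a h1 h2 b).
- move=> h1 h2 /asboolP act1 /asboolP act2; apply/asboolP => y b hy.
  have [[y1 e1] [y2 e2]] := (hpi_surj h1, hpi_surj h2).
  have /color_act_hpi -> : hpi u y = hpi u (y1 * y2).
    by rewrite (hpiM u y1 y2) -e1 -e2; exact: hy.
  rewrite color_actM (act2 y2 b (esym e2)) (act1 y1 _ (esym e1)).
  by rewrite (mulrA h1 h2 b).
Qed.

Lemma color_idempotent_mul_neq0 c (e : H) : in_hecke0 e -> e != 0 ->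
  color_idempotent u c * e != 0.
Proof.
move=> e0; apply: contra => /eqP Le0; have [y ey] := hpi_surj e.
pose L : FA := \prod_(j < n.+1) lagrange u (c j) (fxi F j).
have LE : color_idempotent u c = hpi u L.
  rewrite (big_morph _ (@hpiM _ _ _ u) (hpi1 n u)); apply: eq_bigr => j _.
  by rewrite (lagrange_morph u (hpi1 n u) (@hpiB _ _ _ u) (@hpiM _ _ _ u) (@hpiZ _ _ _ u)).
(* [L * y] represents $L_ce=0$, yet the value computed next is [e]. *)
have : color_act (L * y) [ffun=> 1] c = 0.
  rewrite (@color_act_hpi _ 0) ?color_act0 ?ffunE //.
  by rewrite (hpi0 n u) -Le0 LE ey (hpiM u L y).
rewrite color_actM (color_act_hecke0 _ e0 (esym ey)).
rewrite (act_color_idem u_inj color_act1 color_actB color_actM color_actZ color_act_xi).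
by rewrite eqxx scale1r ffunE mulr1 => ->.
Qed.

End Nonvanishing.

(** * Common eigenvectors *)

Section ZeroHecke.
Variables (A : pzRingType) (M : lmodType A) (N : nat) (T : nat -> A).
Hypothesis TQ : forall i, (i < N)%N -> T i * T i = - T i.
Hypothesis TB : forall i, (i.+1 < N)%N ->
  T i * T i.+1 * T i = T i.+1 * T i * T i.+1.
Hypothesis TC : forall i j, (i.+1 < j < N)%N -> T i * T j = T j * T i.

(* The vectors [T_p ... T_m v] stay eigenvectors of every [T_j] with [j <> p - 1];
   hence the last nonzero one is an eigenvector of all of them. *)
Lemma zero_hecke_chain m (d : nat -> bool) p (w0 : M) : (p <= m < N)%N ->
    T p *: w0 != 0 ->
    (forall j, (j < p)%N -> T j *: w0 = - (w0 *+ d j)) ->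
    (forall j, (p < j <= m)%N ->
       T j *: (T p *: w0) = - ((T p *: w0) *+ d j.-1)) ->
  exists (d' : nat -> bool) (v : M), v != 0 /\
    forall j, (j <= m)%N -> T j *: v = - (v *+ d' j).
Proof.
elim: p w0 => [|p IHp] w0 /andP[le_pm lt_mN] w_neq0 lt_w0 gt_w.
  (* On $T_0w_0$ the generator $T_0$ acts by $-1$, and $T_j$ with the sign that [d] has at $j-1$. *)
  exists (fun j => if j is j'.+1 then d j' else true), (T 0%N *: w0).
  split=> // -[_|j lt_jm]; last by rewrite gt_w.
  by rewrite scalerA TQ ?scaleNr //; apply: leq_ltn_trans lt_mN.
set w := T p.+1 *: w0 in w_neq0 gt_w *.
have Tw_p1 : T p.+1 *: w = - w.
  by rewrite scalerA TQ ?scaleNr //; apply: leq_ltn_trans lt_mN.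
have lt_w j : (j < p)%N -> T j *: w = - (w *+ d j).
  move=> lt_jp; rewrite scalerA TC; last by rewrite ltnS lt_jp (leq_ltn_trans le_pm).
  by rewrite -scalerA lt_w0 ?scalerN ?scalerMnr // ltnW.
have [Tw0|Tw_neq0] := eqVneq (T p *: w) 0.
  (* Here $T_p$ kills [w]: signs are kept below [p], the eigenvalue is 0 at [p] and $-1$ at $p+1$,
     and signs are shifted by one beyond. *)
  exists (fun j => if (j < p)%N then d j else
                   if j == p then false else (j == p.+1) || d j.-1), w.
  split=> // j le_jm; have [/lt_w //|lt_pj|->] := ltngtP j p.
    have [->|jp1] := eqVneq j p.+1; first by rewrite Tw_p1.
    by rewrite gt_w // le_jm andbT ltn_neqAle eq_sym jp1.
  by rewrite Tw0 mulr0n oppr0.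
apply: (IHp w) => //; first by rewrite (ltnW le_pm).
move=> j /andP[lt_pj le_jm]; have [->|jp1] := eqVneq j p.+1.
  (* By the braid relation $T_{p+1}T_pT_{p+1}w_0=T_pT_{p+1}T_pw_0$, which hands the sign of $T_p$ on
     $w_0$ over to $T_{p+1}$. *)
  rewrite /= !scalerA -TB ?(leq_ltn_trans le_pm) //.
  by rewrite -!scalerA lt_w0 // !scalerN !scalerMnr.
have lt_p1j : (p.+1 < j)%N by rewrite ltn_neqAle eq_sym jp1.
rewrite scalerA -TC; last by rewrite lt_p1j (leq_ltn_trans le_jm).
by rewrite -scalerA gt_w ?lt_p1j // !scalerN scalerMnr.
Qed.

(** Induction on the number of generators: if $T_m$ does not kill a common eigenvector [v] of the
    earlier ones, the chain starting with $T_mv$ ends in an eigenvector of all. *)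
Lemma zero_hecke_eigenvector (x : M) m : x != 0 -> (m <= N)%N ->
  exists (d : nat -> bool) (v : M), v != 0 /\
    forall j, (j < m)%N -> T j *: v = - (v *+ d j).
Proof.
move=> x_neq0; elim: m => [|m IHm] lt_mN; first by exists xpred0, x.
have [d [v [v_neq0 dP]]] := IHm (ltnW lt_mN).
have [Tv0|Tv_neq0] := eqVneq (T m *: v) 0.
  exists (fun j => (j != m) && d j), v; split=> // j; rewrite ltnS leq_eqVlt.
  case/predU1P=> [->|lt_jm]; first by rewrite eqxx Tv0 mulr0n oppr0.
  by rewrite dP // neq_ltn lt_jm.
apply: (zero_hecke_chain (p := m)) Tv_neq0 dP _; first by rewrite leqnn.
by move=> j; rewrite ltnNge andNb.
Qed.

End ZeroHecke.

(** * Weight vectors and the lines they span *)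

Section WeightVectors.
Variables (F : fieldType) (n : nat) (A : algType F).
Variables (T : 'I_n -> A) (xi : 'I_n.+1 -> A).

Definition weight_vector (t : 'I_n -> F) (s : 'I_n.+1 -> F)
    (M : lmodType A) (w : M) : Prop :=
  [/\ w != 0, forall i, T i *: w = (t i)%:A *: w
    & forall j, xi j *: w = (s j)%:A *: w].

(** Scalars of [F] act on an [A]-module through [a%:A], which is central in [A]. *)
Lemma scaler_algC (M : lmodType A) (h : A) (a : F) (w : M) :
  h *: (a%:A *: w) = a%:A *: (h *: w).
Proof. by rewrite !scalerA -scalerAr mulr1 mulr_algl. Qed.

Lemma scaler_algM (M : lmodType A) (a b : F) (w : M) :
  a%:A *: (b%:A *: w) = (a * b)%:A *: w.
Proof. by rewrite scalerA mulr_algl scalerA. Qed.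

Lemma scaler_algD (M : lmodType A) (a b : F) (w : M) :
  (a + b)%:A *: w = a%:A *: w + b%:A *: w.
Proof. by rewrite !scalerDl. Qed.

Lemma scalar_inj (M : lmodType A) (w : M) (a b : F) : w != 0 ->
  a%:A *: w = b%:A *: w -> a = b.
Proof.
move=> w0 /eqP; rewrite -subr_eq0 -scalerBl -scalerBl => /eqP ab0.
apply/eqP; rewrite -subr_eq0; apply: contraNT w0 => ab.
have : ((a - b)^-1)%:A *: ((a - b)%:A *: w) = 0 by rewrite ab0 scaler0.
by rewrite scaler_algM mulVf // !scale1r => ->.
Qed.

Lemma one_dimensional_simple (M : lmodType A) :
  one_dimensional M -> simple_module M.
Proof.
move=> [w w0 wP]; split=> [|N [N0 Ncl]]; first by exists w.
have [[x xN x0]|noN] := pselect (exists2 x, x \in N & x != 0); last first.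
  by left=> x xN; apply/eqP; apply: contra_notT noN => x0; exists x.
right=> y; have [[a xE] [b ->]] := (wP x, wP y).
have a0 : a != 0 by apply: contraNneq x0 => a0; rewrite xE a0 !scale0r.
have -> : b%:A *: w = (b / a)%:A *: x + 0.
  by rewrite xE addr0 scaler_algM divfK.
exact: Ncl.
Qed.

Hypothesis A_ind : forall P : A -> Prop,
    P 1 -> (forall x y, P x -> P y -> P (x + y)) ->
    (forall a x, P x -> P (a *: x)) ->
    (forall i x, P x -> P (T i * x)) ->
    (forall j x, P x -> P (xi j * x)) ->
  forall x, P x.

Variables (t : 'I_n -> F) (s : 'I_n.+1 -> F).

(** Both vectors are treated at once so that each [h] has the same eigenvalue on them; this makes
    sending [w] to [w'] an [A]-linear map of lines. *)
Lemma weight_scalar (M M' : lmodType A) (w : M) (w' : M') :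
    weight_vector t s w -> weight_vector t s w' ->
  forall h : A, exists a : F, h *: w = a%:A *: w /\ h *: w' = a%:A *: w'.
Proof.
move=> [_ Tw xw] [_ Tw' xw'].
have comm (N : lmodType A) (v : N) (g x : A) (a b : F) :
    g *: v = b%:A *: v -> x *: v = a%:A *: v -> (g * x) *: v = (a * b)%:A *: v.
  by move=> gv xv; rewrite -[LHS]scalerA xv scaler_algC gv scaler_algM.
apply: A_ind => [|x y [a [xa xa']] [b [yb yb']]|b x [a [xa xa']]
                 |i x [a [xa xa']]|j x [a [xa xa']]].
- by exists 1; rewrite !scale1r.
- by exists (a + b); rewrite !scalerDl xa xa' yb yb'.
- exists (b * a); rewrite -(mulr_algl b x).
  by split; rewrite -[LHS]scalerA ?xa ?xa' scaler_algM.
- by exists (a * t i); split; apply: comm.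
- by exists (a * s j); split; apply: comm.
Qed.

Lemma weight_generator_line (M : lmodType A) (w : M) :
    weight_vector t s w -> (forall x, exists h : A, x = h *: w) ->
  forall x : M, exists a : F, x = a%:A *: w.
Proof.
move=> wW wG x; have [h ->] := wG x.
by have [a [-> _]] := weight_scalar wW wW h; exists a.
Qed.

(** The line through [w] is a nonzero submodule. *)
Lemma simple_weight_line (M : lmodType A) (w : M) :
    simple_module M -> weight_vector t s w ->
  forall x : M, exists a : F, x = a%:A *: w.
Proof.
move=> [_ Msimple] wW x; have [w0 _ _] := wW.
pose N : {pred M} := fun x => `[< exists a : F, x = a%:A *: w >].
have Ncl : submod_closed N.
  split=> [|h _ _ /asboolP[a ->] /asboolP[b ->]]; apply/asboolP.
    by exists 0; rewrite !scale0r.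
  have [e [he _]] := weight_scalar wW wW h; exists (a * e + b).
  by rewrite scaler_algC he scaler_algM scaler_algD.
case: (Msimple N Ncl) => [N0|NT]; last exact/asboolP/NT.
case/eqP: w0; apply: N0; apply/asboolP; exists 1; by rewrite !scale1r.
Qed.

(** Send $aw$ to $aw'$; the coordinate $a$ is obtained by choice and is unique since $w\ne0$. *)
Lemma weight_line_isomorphic (M M' : lmodType A) (w : M) (w' : M') :
    weight_vector t s w -> weight_vector t s w' ->
    (forall x : M, exists a : F, x = a%:A *: w) ->
    (forall x : M', exists a : F, x = a%:A *: w') ->
  isomorphic_modules M M'.
Proof.
move=> wW wW' wG wG'; have [[w0 _ _] [w0' _ _]] := (wW, wW').
pose co x := projT1 (cid (wG x)); have coE x : x = (co x)%:A *: w.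
  exact: projT2 (cid (wG x)).
pose co' x := projT1 (cid (wG' x)); have coE' x : x = (co' x)%:A *: w'.
  exact: projT2 (cid (wG' x)).
pose f x : M' := (co x)%:A *: w'.
have f_lin : linear f.
  move=> h x y; have [e [he he']] := weight_scalar wW wW' h.
  have -> : f (h *: x + y) = (co x * e + co y)%:A *: w'.
    congr (_%:A *: _); apply: (scalar_inj w0); rewrite -coE.
    by rewrite {1}[x]coE {1}[y]coE scaler_algC he scaler_algM scaler_algD.
  by rewrite /f scaler_algC he' scaler_algM scaler_algD.
pose fL := GRing.isLinear.Build A M M' *:%R f f_lin.
exists (HB.pack f fL : {linear M -> M'}).
exists (fun x => (co' x)%:A *: w) => x /=.
  rewrite [RHS]coE; congr (_%:A *: _); apply: (scalar_inj w0').
  by rewrite -coE'.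
rewrite [RHS]coE' /f; congr (_%:A *: _); apply: (scalar_inj w0).
by rewrite -coE.
Qed.

End WeightVectors.

(** Induction on [m], adding one cell in front: a descent at the first position prepends a part 1,
    otherwise the first part grows by one. The old partial sums move up by one in both cases. *)
Lemma composition_of_descents m (P : pred nat) :
  exists I : composition m.+1, forall i, (i < m)%N -> (i.+1 \in descents I) = P i.
Proof.
suff [s [s_pos s_sum s_neq0 sP]] : exists s : seq nat,
    [/\ all (leq 1) s, sumn s = m.+1, s != [::] & forall i, (i < m)%N ->
      (i.+1 \in [seq sumn (take k s) | k <- iota 1 (size s).-1]) = P i].
  have s_comp : all (leq 1) s && (sumn s == m.+1) by rewrite s_pos s_sum eqxx.
  by exists (Composition s_comp).
elim: m P => [|m IHm] P; first by exists [:: 1%N].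
have [[|a s] [s_pos s_sum // _ sP]] := IHm (fun i => P i.+1).
pose D b := [seq sumn (take k (b :: s)) | k <- iota 1 (size s)].
have D_S b i : (i.+1 \in D b.+1) = (i \in D b).
  have -> : D b.+1 = map S (D b).
    rewrite /D -map_comp; apply/eq_in_map => -[|k] //.
    by rewrite mem_iota.
  by rewrite (mem_map succn_inj).
have D0 b : (0 < b)%N -> 0%N \notin D b.
  move=> b0; apply/mapP => -[[|k]]; rewrite mem_iota //= => _ /eqP.
  by rewrite eq_sym addn_eq0 -leqn0 leqNgt b0.
have /andP[a_pos s_pos'] := s_pos.
case P0: (P 0%N).
  exists [:: 1%N, a & s]; split=> // [|i lt_im]; first by rewrite -s_sum.
  rewrite [size _]/= succnK.
  have -> : [seq sumn (take k [:: 1%N, a & s]) | k <- iota 1 (size s).+1]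
            = 1%N :: map S (D a).
    rewrite /=; congr (_ :: _).
    rewrite /D -map_comp (iotaDl 1 1) -map_comp; apply: eq_map => k /=.
    by rewrite add1n.
  rewrite inE; case: i lt_im => [|i] lt_im /=; first by rewrite P0.
  by rewrite (mem_map succn_inj) sP.
exists (a.+1 :: s); split=> //=; first by rewrite addSn -s_sum.
move=> i lt_im; rewrite -/(D a.+1) D_S; case: i lt_im => [|i] lt_im.
  by rewrite P0; apply/negbTE/D0.
exact: sP.
Qed.

(** * Weight vectors obtained by maximizing over colors *)

Section ColorWeights.
Variables (F : fieldType) (n r : nat) (u : 'I_r.+1 -> F).
Hypothesis u_inj : injective u.
Variables (A : algType F) (T : 'I_n -> A) (xi : 'I_n.+1 -> A).
Hypothesis rel : forall x y, hecke_relation u T xi x y -> x = y.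
Local Notation color := {ffun 'I_n.+1 -> 'I_r.+1}.
Implicit Types (i : 'I_n) (c : color) (d : 'I_n -> bool).
Local Notation L c := (color_idem u xi c).

(* [T_i] acts on [L_c eta_I] by -1 if this holds for [d] the descents of [I],
   and by 0 otherwise. *)
Definition ribbon_sign d c i : bool :=
  (c (pos i) < c (pos_next i))%N || (c (pos i) == c (pos_next i)) && d i.

(** Moving $T_i$ past $L_c$ leaves $L_{s_ic}v$ with coefficient $-d_i$ at an ascent of $c$ and
    $1-d_i$ at a drop; the last two hypotheses remove these terms when the coefficient is
    nonzero. *)
Lemma color_weight_vector (M : lmodType A) (v : M) d c :
    (forall i, T i *: v = - (v *+ d i)) -> L c *: v != 0 ->
    (forall i, (c (pos i) < c (pos_next i))%N -> d i ->
       L (swap_color i c) *: v = 0) ->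
    (forall i, (c (pos_next i) < c (pos i))%N -> ~~ d i ->
       L (swap_color i c) *: v = 0) ->
  weight_vector T xi (fun i => - (ribbon_sign d c i)%:R) (u \o c) (L c *: v).
Proof.
move=> Tv Lv_neq0 asc0 desc0; split=> // [i|j]; last first.
  by rewrite scalerA (color_idem_eigen rel) -[_ *: L c]mulr_algl -[LHS]scalerA.
rewrite [LHS]scalerA (T_color_idem u_inj rel) scalerBl scalerDl.
rewrite -[(_ * T i) *: v]scalerA Tv /ribbon_sign scalerN -scalerMnr.
have [lt_c|gt_c|eq_c] := ltngtP (c (pos i)) (c (pos_next i)); rewrite /=.
- rewrite scale0r scale0r addr0 scale1r !scaleN1r.
  suff -> : (L (swap_color i c) *: v) *+ d i = 0 by rewrite oppr0 add0r.
  by case di: (d i); rewrite // (asc0 i lt_c di) mul0rn.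
- rewrite -val_eqE /= gtn_eqF //= scale1r oppr0 !scale0r subr0.
  by case: (boolP (d i)) => [|/(desc0 i gt_c) ->]; rewrite ?addNr ?mul0rn ?oppr0 ?addr0.
- rewrite !scale0r subr0 addr0 (swap_color_id (val_inj eq_c)) -val_eqE /= eq_c eqxx /=.
  by case: (d i); rewrite ?scaleN1r ?oppr0 ?scale0r.
Qed.

Definition zigzag d (k : nat) : int :=
  \sum_(l < n | (l < k)%N) (if d l then -1 else 1).

Lemma zigzagS d i : zigzag d i.+1 = zigzag d i + (if d i then -1 else 1).
Proof.
rewrite /zigzag (bigD1 i) ?ltnSn //= addrC; congr (_ + _).
by apply: eq_bigl => l; rewrite ltnS ltn_neqAle andbC.
Qed.

Definition color_height d c : int :=
  \sum_(j < n.+1) zigzag d j * (c j : nat)%:Z.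

(** Only the two swapped positions change, and their weights [zigzag] differ by one. *)
Lemma color_height_swap d c i :
  color_height d (swap_color i c) = color_height d c
    + (if d i then -1 else 1) * ((c (pos i) : nat)%:Z - (c (pos_next i) : nat)%:Z).
Proof.
have ni : pos_next i != pos i by rewrite eq_sym pos_neq_next.
rewrite /color_height (bigD1 (pos i)) //= (bigD1 (pos_next i)) //=.
rewrite [in RHS](bigD1 (pos i)) //= [in RHS](bigD1 (pos_next i)) //=.
rewrite swap_color_pos swap_color_next.
rewrite (eq_bigr (fun j => zigzag d (nat_of_ord j) * (c j : nat)%:Z)); last first.
  by move=> j /andP[jp jn]; rewrite swap_color_far.
rewrite /bump /= add1n zigzagS; ring.
Qed.

Lemma exists_weight_vector (M : lmodType A) (x : M) : x != 0 ->
  exists d c (w : M),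
    weight_vector T xi (fun i => - (ribbon_sign d c i)%:R) (u \o c) w.
Proof.
(* The generators are extended by 0 to all natural indices, the form taken by
   [zero_hecke_eigenvector]. *)
move=> x_neq0; pose T' k := if insub k is Some i then T i else 0.
have T'E i : T' i = T i by rewrite /T' valK.
have T'Q k : (k < n)%N -> T' k * T' k = - T' k.
  move=> lt_k; rewrite -[k]/(val (Ordinal lt_k)) T'E; set i := Ordinal lt_k.
  apply/eqP; rewrite -addr_eq0 -{3}[T i]mulr1 -mulrDr.
  by rewrite (rel (rel_quad u T xi i)).
have T'B k : (k.+1 < n)%N -> T' k * T' k.+1 * T' k = T' k.+1 * T' k * T' k.+1.
  move=> lt_k; have lt_k' := ltnW lt_k.
  rewrite -[k.+1]/(val (Ordinal lt_k)) -[k]/(val (Ordinal lt_k')) !T'E.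
  exact: (rel (rel_braid _ _ _ _)).
have T'C k l : (k.+1 < l < n)%N -> T' k * T' l = T' l * T' k.
  move=> /andP[lt_kl lt_l]; have lt_k : (k < n)%N by lia.
  rewrite -[k]/(val (Ordinal lt_k)) -[l]/(val (Ordinal lt_l)) !T'E.
  by apply: (rel (rel_TT _ _ _ _)); rewrite /= lt_kl.
have [d0 [v [v_neq0 vP]]] := zero_hecke_eigenvector T'Q T'B T'C x_neq0 (leqnn n).
pose d i := d0 i; have Tv i : T i *: v = - (v *+ d i) by rewrite -T'E vP.
(* Since the $L_c$ add up to 1, one of them does not kill [v]. *)
have [c0 c0P] : exists c0, L c0 *: v != 0.
  apply/existsP; apply: contraNT v_neq0; rewrite negb_exists => /forallP Lv0.
  rewrite -[v]scale1r -(sum_color_idem u_inj xi) scaler_suml big1 // => c _.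
  by have := Lv0 c; rewrite negbK => /eqP.
case: (@arg_maxP _ _ _ c0 (fun c => L c *: v != 0) (color_height d) c0P).
move=> c cP c_max; exists d, c, (L c *: v).
(* A nonzero $L_{s_ic}v$ at an unwanted swap would exceed the maximal height. *)
apply: color_weight_vector => // i ci di; apply/eqP; apply: contraTT isT => sv_neq0;
  have := c_max _ sv_neq0; rewrite color_height_swap ?di ?(negPf di); lia.
Qed.

End ColorWeights.

(** * Cycloribbon modules *)

Section PrincipalLideal.
Variables (F : fieldType) (n : nat) (A : algType F) (x : A).
Variables (T : 'I_n -> A) (xi : 'I_n.+1 -> A).

Lemma principal_gen_subproof : (x : A^o) \in principal_pred x.
Proof. by apply/asboolP; exists 1; rewrite mul1r. Qed.

Definition principal_gen : principal_lideal x :=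
  PrincipalLideal principal_gen_subproof.

Lemma principal_genP (y : principal_lideal x) : exists h : A, y = h *: principal_gen.
Proof.
by case: y => y yP; case/asboolP: (yP) => h yE; exists h; apply: val_inj.
Qed.

Lemma principal_gen_weight t s :
  weight_vector T xi t s (x : A^o) -> weight_vector T xi t s principal_gen.
Proof.
case=> x_neq0 Tx xix; split=> [|i|j]; last 2 first.
- by apply: val_inj; apply: Tx.
- by apply: val_inj; apply: xix.
by apply: contra x_neq0 => /eqP/(congr1 val) /= ->.
Qed.

End PrincipalLideal.

Section CycloribbonModules.
Variables (F : fieldType) (n r : nat) (u : 'I_r.+1 -> F).
Hypothesis u_inj : injective u.
Local Notation H := (hecke n u).
Local Notation color := {ffun 'I_n.+1 -> 'I_r.+1}.

(** A cycloribbon has no color ascent at a descent of [I] and no color drop elsewhere, so the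
    vanishing conditions of [color_weight_vector] hold vacuously. *)
Lemma cycloribbon_weight (I : composition n.+1) (c : color) (e : H) :
    is_eta I e -> cycloribbon I c ->
  weight_vector (hT u) (hxi u)
    (fun i => - (ribbon_sign (is_descent I) c i)%:R) (u \o c)
    (principal_gen (color_idempotent u c * e) : cycloribbon_module e c).
Proof.
move=> [e0 e_neq0 eD eN] Ic; apply: principal_gen_weight.
apply: (@color_weight_vector F n r u u_inj H (hT u) (hxi u)
  (@hecke_relation_eq F n r u) H^o (e : H^o)) => [i||i|i].
- have [/eD Te|/eN Te] := boolP (is_descent I i).
    by rewrite -[in RHS]Te mulNr opprK.
  (* Cancelling [e] in $(1+T_i)e=e$ gives $T_ie=0$. *)
  apply: (addrI (1 * e)); rewrite [in RHS]mul1r -[RHS]/(e + - 0) subr0.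
  by rewrite -[RHS]Te mulrDl.
- exact: color_idempotent_mul_neq0.
- by move=> lt_c /(Ic i).1; rewrite leqNgt lt_c.
- by move=> gt_c /(Ic i).2; rewrite leqNgt gt_c.
Qed.

Lemma cycloribbon_line (I : composition n.+1) (c : color) (e : H) :
    is_eta I e -> cycloribbon I c ->
  forall y : cycloribbon_module e c, exists a : F,
    y = a%:A *: (principal_gen (color_idempotent u c * e) : cycloribbon_module e c).
Proof.
move=> eI Ic; apply: (weight_generator_line (@hecke_ind F n r u)
  (cycloribbon_weight eI Ic)).
exact: principal_genP.
Qed.

(** The sign reads [d] only where neighboring colors agree; elsewhere the descents of [I] may be
    dictated by [c]. *)
Lemma exists_cycloribbon (d : 'I_n -> bool) (c : color) :
  exists2 I : composition n.+1, cycloribbon I c &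
    ribbon_sign (is_descent I) c = ribbon_sign d c.
Proof.
pose D (i : 'I_n) := (c (pos_next i) < c (pos i))%N ||
  (c (pos i) == c (pos_next i)) && d i.
have [I IP] := composition_of_descents n
  (fun k => if insub k is Some i then D i else false).
have {}IP i : is_descent I i = D i by rewrite /is_descent IP // valK.
exists I => [i|]; first by rewrite IP /D -val_eqE /=; case: ltngtP.
by apply/funext => i; rewrite /ribbon_sign IP /D -val_eqE /=; case: ltngtP.
Qed.

End CycloribbonModules.

Theorem theorem5p4 (R : realType) (n r : nat) (u : 'I_r.+1 -> R[i])
    (u_inj : injective u)
    (eta : composition n.+1 -> hecke n u)
    (etaP : forall I : composition n.+1, is_eta I (eta I)) :
  [/\ forall (I : composition n.+1) (c : {ffun 'I_n.+1 -> 'I_r.+1}),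
        cycloribbon I c -> simple_module (cycloribbon_module (eta I) c),
      forall M : lmodType (hecke n u), simple_module M ->
        exists (I : composition n.+1) (c : {ffun 'I_n.+1 -> 'I_r.+1}),
          cycloribbon I c /\
          isomorphic_modules M (cycloribbon_module (eta I) c)
    & forall M : lmodType (hecke n u), simple_module M -> one_dimensional M].
Proof.
pose rel := @hecke_relation_eq _ n r u.
pose gen := @hecke_ind _ n r u.
split=> [I c Ic|M Msimple|M Msimple].
- apply: one_dimensional_simple.
  have [w_neq0 _ _] := cycloribbon_weight u_inj (etaP I) Ic.
  exists (principal_gen (color_idempotent u c * eta I)) => //.
  exact: (cycloribbon_line u_inj (etaP I) Ic).
- have [[x x_neq0] _] := Msimple.
  have [d [c [w wW]]] := exists_weight_vector u_inj rel x_neq0.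
  (* [I] is chosen from the weight of [w], so that the cycloribbon module has the same weight. *)
  have [I Ic Id] := exists_cycloribbon d c; exists I, c; split=> //.
  have wW' := cycloribbon_weight u_inj (etaP I) Ic.
  rewrite Id in wW'; apply: (weight_line_isomorphic gen wW wW').
  + exact: (simple_weight_line gen Msimple wW).
  + exact: (cycloribbon_line u_inj (etaP I) Ic).
- have [[x x_neq0] _] := Msimple.
  have [d [c [w wW]]] := exists_weight_vector u_inj rel x_neq0.
  have [w_neq0 _ _] := wW.
  by exists w => //; apply: (simple_weight_line gen Msimple wW).
Qed.
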